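(* Let $\rho\in\mathcal{S}_+^{\rm mon}$, $1<q<\infty$ and $\alpha\in\mathbb{N}$. There is a constant $C>0$, independent of $n$, such that for every $n\in\mathbb{N}$ and every linear quadrature of the form $$A_{\rho,n}(f)=\sum_{j=1}^n w_j f(x_j),\qquad w_j\in\mathbb{R},\ x_j\in\mathbb{R},$$ one has $$\big\|I_\rho-A_{\rho,n}\big\|_{\mathscr{L}(W^{\alpha,q}_\rho(\mathbb{R}),\mathbb{C})}=\sup_{0\ne f\in W^{\alpha,q}_\rho(\mathbb{R})}\frac{|I_\rho(f)-A_{\rho,n}(f)|}{\|f\|_{W^{\alpha,q}_\rho(\mathbb{R})}}\ \ge\ C\,\frac{1}{n^\alpha}.$$
   Context: $\mathbb{N}=\{1,2,\dots\}$, $\mathbb{N}_0=\mathbb{N}\cup\{0\}$. Monotonic Schwartz weights: $\mathcal{S}$ is the Schwartz space of $\omega\in C^\infty(\mathbb{R})$ with $\sup_{x\in\mathbb{R}}|x^a\omega^{(b)}(x)|<\infty$ for all $a,b\in\mathbb{N}_0$. $\mathcal{S}_+^{\rm mon}$ is the set of real-valued $\omega\in\mathcal{S}$ with $\omega(x)>0$ for all $x\in\mathbb{R}$ for which there exists $K>0$ such that $x\,\omega'(x)\le 0$ for all $x\in\mathbb{R}\setminus[-K,K]$. Weighted Sobolev space: for $1<q<\infty$, $\alpha\in\mathbb{N}$, $W^{\alpha,q}_\rho(\mathbb{R})$ is the space of functions $f:\mathbb{R}\to\mathbb{C}$ with weak derivatives $f^{(\tau)}$, $\tau=0,\dots,\alpha$,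 and $\|f\|_{W^{\alpha,q}_\rho(\mathbb{R})}=\big(\sum_{\tau=0}^\alpha\int_{\mathbb{R}}|f^{(\tau)}(x)|^q\rho(x)\,dx\big)^{1/q}<\infty$. The continuous representative of $f$ is always used, so point evaluations are well defined. $I_\rho(f)=\int_{\mathbb{R}}f(x)\rho(x)\,dx$. $\mathscr{L}(X,Y)$ denotes bounded linear operators with the operator norm. *)

(* Defs.v *)
From HB Require Import structures.
From mathcomp Require Export all_boot all_order all_algebra.
From mathcomp Require Export complex.
From mathcomp Require Export all_classical all_reals all_analysis.

Set Implicit Arguments.
Unset Strict Implicit.
Unset Printing Implicit Defensive.

Export numFieldNormedType.Exports.
Import Order.TTheory GRing.Theory Num.Theory.

Local Open Scope classical_set_scope.
Local Open Scope ring_scope.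
Local Open Scope complex_scope.

Section Weights.
Variable R : realType.
Implicit Types omega : R -> R.

Definition smooth omega := forall (n : nat) (x : R), derivable (derive1n n omega) x 1.

(* Only real-valued Schwartz functions are needed: every monotonic weight is
   real-valued. *)
Definition schwartz omega :=
  smooth omega /\
  forall a b : nat, exists M : R,
    forall x : R, `|x ^+ a * derive1n b omega x| <= M.

Definition schwartz_mon_pos omega :=
  [/\ schwartz omega,
      forall x : R, 0 < omega x &
      exists2 K : R, 0 < K &
        forall x : R, x \notin `[- K, K] -> x * derive1 omega x <= 0].

Definition test_function (phi : R -> R) :=
  smooth phi /\ compact (closure [set x | phi x != 0]).

End Weights.

Section Sobolev.
Variable R : realType.
Local Notation C := R[i].
Local Notation mu := (@lebesgue_measure R).

(* The library's integral is real-valued; the integral of a complex function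
   is taken componentwise. *)
Definition cintegral (f : R -> C) : C :=
  Rintegral mu setT (fun x => complex.Re (f x)) +i*
  Rintegral mu setT (fun x => complex.Im (f x)).

Definition clocally_integrable (f : R -> C) :=
  locally_integrable setT (fun x => complex.Re (f x)) /\
  locally_integrable setT (fun x => complex.Im (f x)).

(* Testing against real-valued functions suffices, by linearity. *)
Definition weak_derivative (k : nat) (f g : R -> C) :=
  [/\ clocally_integrable f, clocally_integrable g &
      forall phi : R -> R, test_function phi ->
        cintegral (fun x => f x * (derive1n k phi x)%:C) =
        (-1) ^+ k * cintegral (fun x => g x * (phi x)%:C)].

(* [ComplexField.Normc.normc z] is the modulus of [z] as an element of [R]. *)
Definition weighted_sobolev_norm (alpha : nat) (q : R) (rho : R -> R)
    (D : nat -> R -> C) : \bar R :=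
  ((\sum_(0 <= tau < alpha.+1)
      \int[mu]_(x in [set: R])
        ((ComplexField.Normc.normc (D tau x)) `^ q * rho x)%R%:E)
    `^ (q^-1))%E.

(* [f], with weak derivatives [D 0], ..., [D alpha], is the continuous
   representative of an element of the weighted Sobolev space.  Weak derivatives
   are unique almost everywhere, so the norm of [D] depends on [f] only;
   [C^o] carries the usual topology of the complex numbers. *)
Definition weighted_sobolev (alpha : nat) (q : R) (rho : R -> R)
    (f : R -> C) (D : nat -> R -> C) :=
  [/\ continuous (f : R -> C^o),
      forall tau : nat, (tau <= alpha)%N -> weak_derivative tau f (D tau) &
      (weighted_sobolev_norm alpha q rho D < +oo)%E].

Definition operator_norm (alpha : nat) (q : R) (rho : R -> R)
    (T : (R -> C) -> C) : \bar R :=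
  ereal_sup [set r | exists (f : R -> C) (D : nat -> R -> C),
    [/\ weighted_sobolev alpha q rho f D,
        f <> (fun=> 0) &
        r = (ComplexField.Normc.normc (T f) /
             fine (weighted_sobolev_norm alpha q rho D))%:E]].

Definition weighted_integral (rho : R -> R) (f : R -> C) : C :=
  cintegral (fun x => f x * (rho x)%:C).

Definition quadrature (n : nat) (w x : 'I_n -> R) (f : R -> C) : C :=
  \sum_(j < n) (w j)%:C * f (x j).

End Sobolev.

(* Main.v *)
Require Import Defs.
From mathcomp Require Import all_boot all_order all_algebra.
From mathcomp Require Import complex.
From mathcomp Require Import all_classical all_reals all_analysis.
From mathcomp Require Import measurable_realfun.
From mathcomp Require Import ring lra zify.

(** The bound holds because a quadrature with [n] nodes cannot see a function
    that vanishes at all of them, and such a function can be chosen with a large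
    integral and a small norm.

    Cut [0, 1] into [2n] cells of length [1/(2n)].  A node is interior to at
    most one cell, so at least [n] cells contain no node in their interior
    ([free_cells]).  Put into each of [n] such cells a rescaled copy of one fixed
    nonnegative bump supported on [0, 1], and let [f] be the sum
    ([bump_train]).  Then the quadrature of [f] is 0, so that the error at [f] is
    the integral of [f] against the weight.
    - Each of the [n] copies contributes at least a constant times [1/n] to
      this integral, because the weight is bounded below on [0, 1]; hence the
      error is bounded below independently of [n]
      ([integral_bump_train_ge]).
    - The copies are nonzero on disjoint sets, so the [k]-th derivative of [f] is at
      most [(2n)^k] times the maximum of the [k]-th derivative of the bump.
      The weight being bounded on [0, 1], the Sobolev norm of [f] is at most a
      constant times [n^alpha] ([weighted_sobolev_norm_le]).
    The quotient of the two estimates is the claim.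

    A bump of class C^(alpha+1) is enough, and this allows an explicit one,
    [max(0, x(1-x))^(alpha+2)], whose derivatives of order up to [alpha] are
    again polynomials times powers of [max(0, x(1-x))].  Classical derivatives
    that vanish outside [0, 1] are weak derivatives by repeated integration by
    parts on [0, 1], without boundary terms
    ([repeated_integration_by_parts]). *)

Set Implicit Arguments.
Unset Strict Implicit.
Unset Printing Implicit Defensive.
Import Order.TTheory GRing.Theory Num.Theory numFieldNormedType.Exports.
Local Open Scope classical_set_scope.
Local Open Scope ring_scope.

(** * Powers of the positive part *)

(** The difference quotient at 0 of [t * g t] is [g] itself, so continuity of
    [g] at 0 is what makes it converge. *)
Lemma is_derive_mul_idfun (R : realType) (g : R -> R) : {for 0, continuous g} ->
  is_derive (0 : R) (1 : R) (fun t => t * g t) (g 0).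
Proof.
move=> cg.
have H : h^-1 *: (((fun t => t * g t) \o shift 0) (h *: 1) - (0 * g 0))
    @[h --> (0:R)^'] --> g 0.
  have cg' : g h @[h --> (0:R)^'] --> g 0 by apply: cvg_within_filter; exact: cg.
  apply: cvg_trans cg'.
  apply: near_eq_cvg; near=> h.
  have h0 : h != 0 by near: h; exact: nbhs_dnbhs_neq.
  rewrite /= mul0r subr0 addr0 scaler1 /GRing.scale/=.
  by rewrite mulrA mulVf// mul1r.
split; last exact/cvg_lim.
by apply/cvg_ex; exists (g 0).
Unshelve. all: by end_near. Qed.

(** Only the point 0 needs an argument: there [max(0, t)^(m+2)] is [t] times a
    continuous function that vanishes at 0. *)
Lemma is_derive_max0X (R : realType) m (x : R) :
  is_derive x 1 (fun t => Num.max 0 t ^+ m.+2) (m.+2%:R * Num.max 0 x ^+ m.+1).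
Proof.
case: (ltgtP x 0) => [x0|x0|->].
- rewrite exprS mul0r mulr0.
  apply: (@near_eq_is_derive R R R (fun=> 0)).
  near=> t; have t0 : t <= 0 by apply: ltW; near: t; exact: lt_nbhsl.
  by rewrite max_l// expr0n.
- apply: (@near_eq_is_derive R R R (fun t : R => t ^+ m.+2)); last first.
    have -> : (fun t : R => t ^+ m.+2) = (@idfun R) ^+ m.+2 by rewrite exprfctE.
    by apply: is_derive_eq; rewrite /GRing.scale/= mulr1.
  near=> t; have t0 : 0 <= t by apply: ltW; near: t; exact: lt_nbhsr.
  by rewrite max_r.
- rewrite ?maxxx exprS mul0r mulr0.
  have -> : (fun t : R => Num.max 0 t ^+ m.+2) = (fun t => t * Num.max 0 t ^+ m.+1).
    apply/funext => t; rewrite exprS; case: (leP 0 t) => t0; first by [].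
    by rewrite exprS !mul0r mulr0.
  have := @is_derive_mul_idfun _ (fun t : R => Num.max 0 t ^+ m.+1).
  rewrite maxxx expr0n; apply.
  apply: (@continuous_comp _ _ _ (fun t : R => Num.max 0 t) (fun t => t ^+ m.+1)).
    by apply: continuous_max; [exact: cvg_cst|exact: cvg_id].
  exact: exprn_continuous.
Unshelve. all: by end_near. Qed.

(** * A polynomial bump on the unit interval *)

Definition hump (R : realType) : {poly R} := 'X * (1 - 'X).

(** With [p = x(1-x)] and [N = A+2], the [k]-th derivative of [max(0, p)^N] is
    [u_k * max(0, p)^(N-k)], where differentiating once more gives
    [u_(k+1) = u_k' p + (N-k) u_k p']; [polybump_cofactor] is this [u_k]. *)
Fixpoint polybump_cofactor (R : realType) (A k : nat) : {poly R} :=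
  if k is j.+1 then
    (polybump_cofactor R A j)^`() * hump R
    + (A.+2 - j)%:R *: (polybump_cofactor R A j * (hump R)^`())
  else 1.

(** The bump [max(0, x(1-x))^(A+2)] for [k = 0], and its [k]-th derivative for
    [k <= A+1].  The exponent [A+2] leaves a power of at least 2, hence
    differentiability at the ends of [0, 1], for every [k <= A]. *)
Definition polybump (R : realType) (A k : nat) (x : R) : R :=
  (polybump_cofactor R A k).[x] * Num.max 0 (hump R).[x] ^+ (A.+2 - k).

Lemma humpE (R : realType) (x : R) : (hump R).[x] = x * (1 - x).
Proof. by rewrite /hump !hornerE. Qed.

Lemma is_derive_polybump (R : realType) A k (x : R) : (k <= A)%N ->
  is_derive x 1 (polybump A k) (polybump A k.+1 x).
Proof.
move=> kA.
have e1 : (A.+2 - k = (A - k).+2)%N by rewrite subSn ?subSn// (leq_trans kA).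
have e2 : (A.+2 - k.+1 = (A - k).+1)%N by rewrite subSS subSn.
have -> : @polybump R A k = horner (polybump_cofactor R A k) *
    ((fun t => Num.max 0 t ^+ (A - k).+2) \o horner (hump R)).
  by apply/funext => t; rewrite /polybump e1.
have := is_derive_max0X (A - k) (hump R).[x] => d1.
apply: is_derive_eq.
rewrite /polybump /= e1 e2 /GRing.scale/= !hornerE /=.
set p := x * (1 - x).
(* Trading one factor [max(0, p)] for [p] lowers the exponent of the term that
   comes from differentiating the cofactor. *)
have -> : Num.max 0 p ^+ (A - k).+2 = p * Num.max 0 p ^+ (A - k).+1.
  by rewrite exprS; case: (leP 0 p) => // _; rewrite exprS !(mul0r,mulr0).
rewrite /p; ring.
Qed.

Lemma polybump_out (R : realType) A k (x : R) : (k <= A)%N ->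
  ~~ (0 < x < 1) -> polybump A k x = 0.
Proof.
move=> kA h; rewrite /polybump humpE max_l; last first.
  by move: h; rewrite negb_and -!leNgt => /orP[]h; nra.
by rewrite subSn ?(leq_trans kA)// exprS mul0r mulr0.
Qed.

Lemma polybump_ge0 (R : realType) A (x : R) : 0 <= polybump A 0 x.
Proof. by rewrite /polybump /= hornerC mul1r exprn_ge0// le_max lexx. Qed.

Lemma polybump_middle (R : realType) A (x : R) :
  4^-1 <= x <= 3 / 4 -> 16^-1 ^+ A.+2 <= polybump A 0 x.
Proof.
move=> /andP[x1 x2]; rewrite /polybump /= hornerC mul1r subn0 humpE.
have h : 16^-1 <= x * (1 - x) by nra.
have h0 : 0 <= 16^-1 :> R by rewrite invr_ge0.
by rewrite max_r ?(le_trans h0)// lerXn2r ?nnegrE// (le_trans h0).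
Qed.

Lemma polybump_continuous (R : realType) A k : (k <= A)%N -> continuous (@polybump R A k).
Proof.
move=> kA x; apply: differentiable_continuous; apply/derivable1_diffP.
by have [] := is_derive_polybump x kA.
Qed.

Lemma polybump_bounded (R : realType) A : exists2 B : R, 0 < B &
  forall k x, (k <= A)%N -> `|polybump A k x| <= B.
Proof.
have H k : (k <= A)%N -> exists2 B : R, 0 <= B & forall x, `|polybump A k x| <= B.
  move=> kA.
  have ct : {within `[0:R, 1], continuous (fun x => `|polybump A k x|)}.
    apply: continuous_subspaceT => x.
    by apply: cvg_norm; exact: polybump_continuous.
  have [c _ hc] := EVT_max ler01 ct.
  exists `|polybump A k c| => // x.
  have [x01|] := boolP (0 < x < 1); last by move/(polybump_out kA) ->; rewrite normr0.
  by apply: hc; rewrite in_itv/=; case/andP: x01 => /ltW-> /ltW->.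
have : forall N, (N <= A)%N ->
    exists2 B : R, 0 < B & forall k x, (k <= N)%N -> `|polybump A k x| <= B.
  elim=> [|N IH] NA.
    have [B B0 HB] := H 0%N NA; exists (B + 1) => [|k x]; first by lra.
    by rewrite leqn0 => /eqP ->; apply: le_trans (HB x) _; lra.
  have [B B0 HB] := H N.+1 NA; have [B' B'0 HB'] := IH (ltnW NA).
  exists (B + B') => [|k x]; first by lra.
  rewrite leq_eqVlt ltnS => /orP[/eqP->|/HB' h].
    by apply: le_trans (HB x) _; lra.
  by apply: le_trans (h x) _; lra.
by move=> /(_ A (leqnn _)).
Qed.

(** * Trains of bumps, and cells without nodes *)

(** For [k <= A+1], the [k]-th derivative of the sum of the copies of the bump
    that are rescaled to the cells from [i/m] to [(i+1)/m], for [i] in [s]. *)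
Definition bump_train (R : realType) (A m : nat) (s : seq nat) (k : nat) (x : R) : R :=
  m%:R ^+ k * \sum_(i <- s) polybump A k (m%:R * x - i%:R).

Lemma is_derive_bump_train (R : realType) A m s k (x : R) : (k <= A)%N ->
  is_derive x 1 (bump_train A m s k) (bump_train A m s k.+1 x).
Proof.
move=> kA; rewrite /bump_train exprSr -mulrA mulr_sumr.
have d i : is_derive x 1 (polybump A k \o (fun t : R => m%:R * t - i%:R))
    (polybump A k.+1 (m%:R * x - i%:R) * m%:R).
  have db := is_derive_polybump (m%:R * x - i%:R) kA.
  apply: is_derive1_comp.
  by apply: is_derive_eq; rewrite /GRing.scale/= subr0 mulr1.
have ds : is_derive x 1 (fun t : R => \sum_(i <- s) polybump A k (m%:R * t - i%:R))
    (\sum_(i <- s) m%:R * polybump A k.+1 (m%:R * x - i%:R)).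
  elim: s => [|a s IH].
    rewrite big_nil; under [X in is_derive _ _ X _]eq_fun do rewrite big_nil.
    exact: is_derive_cst.
  rewrite big_cons; under [X in is_derive _ _ X _]eq_fun do rewrite big_cons.
  by rewrite mulrC; apply: is_deriveD.
exact: is_deriveZ.
Qed.

Lemma bump_train_continuous (R : realType) A m s k : (k <= A)%N ->
  continuous (@bump_train R A m s k).
Proof.
move=> kA x; apply: differentiable_continuous; apply/derivable1_diffP.
by have [] := is_derive_bump_train m s x kA.
Qed.

Lemma bump_train_eq0 (R : realType) A m s k (x : R) : (k <= A)%N ->
  (forall i, i \in s -> ~~ (0 < m%:R * x - i%:R < 1)) ->
  bump_train A m s k x = 0.
Proof.
move=> kA h; rewrite /bump_train big_seq big1 ?mulr0// => i /h.
exact: polybump_out.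
Qed.

Lemma bump_train_out (R : realType) A m s k (x : R) : (k <= A)%N ->
  (forall i, i \in s -> (i < m)%N) -> ~~ (0 < x < 1) -> bump_train A m s k x = 0.
Proof.
move=> kA sm x01; apply: bump_train_eq0 => // i /sm im.
apply: contra x01 => /andP[h1 h2].
have i0 : 0 <= i%:R :> R by [].
have m0 : 0 < m%:R :> R by rewrite ltr0n (leq_trans _ im).
have im' : i%:R + 1 <= m%:R :> R by rewrite natr1 ler_nat.
by apply/andP; split; nra.
Qed.

(** The cells are disjoint, so at each point at most one term of the sum is
    nonzero: the bound does not grow with the number of cells. *)
Lemma bump_train_bounded (R : realType) A m s k (B x : R) : (k <= A)%N ->
  uniq s -> (forall y : R, `|polybump A k y| <= B) ->
  `|bump_train A m s k x| <= m%:R ^+ k * B.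
Proof.
move=> kA us hB; rewrite /bump_train normrM normrX ger0_norm//.
apply: ler_wpM2l; first by rewrite exprn_ge0.
elim: s us => [_|a s IH /= /andP[as_ us]].
  by rewrite big_nil normr0; apply: le_trans (hB 0); exact: normr_ge0.
rewrite big_cons.
have [h|h] := boolP (0 < m%:R * x - a%:R < 1); last first.
  by rewrite (polybump_out kA h) add0r IH.
rewrite big_seq big1 ?addr0// => i si; apply: polybump_out => //.
apply/negP => h'; move: as_; suff -> : a = i by rewrite si.
move/andP: h => [h1 h2]; move/andP: h' => [h3 h4].
have : a%:R < i%:R + 1 :> R by lra.
have : i%:R < a%:R + 1 :> R by lra.
by rewrite !natr1 !ltr_nat; lia.
Qed.

(** Pigeonhole: [truncn (2n * x_j)] is the only cell that can contain the node
    [x_j] in its interior, so at most [n] of the [2n] cells are hit. *)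
Lemma free_cells (R : realType) n (x : 'I_n -> R) : exists s : seq nat,
  [/\ uniq s, size s = n :> nat, forall i, i \in s -> (i < 2 * n)%N &
  forall i j, i \in s -> ~~ (0 < (2 * n)%:R * x j - i%:R < 1)].
Proof.
set m := (2 * n)%N.
pose hit (i : nat) := [exists j, 0 < m%:R * x j - i%:R < 1].
pose s := [seq i <- iota 0 m | ~~ hit i].
have cnt : (count hit (iota 0 m) <= n)%N.
  rewrite -size_filter.
  pose c := [seq Num.truncn (m%:R * x j) | j <- enum 'I_n].
  have <- : size c = n by rewrite size_map size_enum_ord.
  apply: uniq_leq_size; first by rewrite filter_uniq// iota_uniq.
  move=> i; rewrite mem_filter => /andP[/existsP[j /andP[h1 h2]] _].
  apply/mapP; exists j; first by rewrite mem_enum.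
  by symmetry; apply: truncn_def; apply/andP; split; [lra|rewrite -natr1; lra].
have ns : (n <= size s)%N.
  have := count_predC hit (iota 0 m); rewrite size_iota -size_filter.
  rewrite -[count (predC hit) _]size_filter -/s size_filter; rewrite /m.
  by move: cnt; rewrite /m; lia.
have sub i : i \in take n s -> i \in s by exact: mem_take.
exists (take n s); split.
- by rewrite take_uniq// filter_uniq// iota_uniq.
- by rewrite size_take; case: ltnP => // ?; apply/eqP; rewrite eqn_leq ns andbT.
- by move=> i /sub; rewrite mem_filter mem_iota => /andP[].
- move=> i j /sub; rewrite mem_filter => /andP[+ _].
  by rewrite negb_exists => /forallP.
Qed.

(** * Integration of functions supported in the unit interval *)

Lemma integral_supp01 (R : realType) (g : R -> R) :
  (forall x, ~~ (0 < x < 1) -> g x = 0) ->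
  (\int[lebesgue_measure]_x (g x)%:E =
   \int[lebesgue_measure]_(x in `[0%R, 1%R]) (g x)%:E)%E.
Proof.
move=> g0; rewrite [RHS]integral_mkcond; apply: eq_integral => x _.
rewrite patchE; case: ifPn => // /negP x01; congr EFin; apply: g0.
apply/negP => /andP[h1 h2]; apply: x01.
by rewrite inE/= in_itv/= !ltW.
Qed.

(** [F] and [f] kill both integrands outside [0, 1], and [F] is zero at 0 and 1,
    so this is integration by parts on [0, 1] without boundary terms. *)
Lemma integration_by_parts_supp01 (R : realType) (F G f g : R -> R) :
  (forall x : R, is_derive x 1 F (f x)) -> (forall x : R, is_derive x 1 G (g x)) ->
  continuous f -> continuous g ->
  (forall x, ~~ (0 < x < 1) -> F x = 0) ->
  (forall x, ~~ (0 < x < 1) -> f x = 0) ->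
  Rintegral lebesgue_measure setT (fun x => F x * g x) =
  - Rintegral lebesgue_measure setT (fun x => f x * G x).
Proof.
move=> dF dG cf cg F0 f0.
have LR (H h : R -> R) : (forall x : R, is_derive x 1 H (h x)) ->
    derivable_oo_LRcontinuous H 0 1.
  move=> dH.
  have cH x : {for x, continuous H}.
    by apply: differentiable_continuous; apply/derivable1_diffP; case: (dH x).
  split; first by move=> x _; case: (dH x).
    exact: cvg_at_right_filter (cH 0).
  exact: cvg_at_left_filter (cH 1).
rewrite /Rintegral integral_supp01 => [|x /F0 ->]; last by rewrite mul0r.
rewrite [in RHS]integral_supp01 => [|x /f0 ->]; last by rewrite mul0r.
have := @Rintegration_by_parts R F G f g 0 1 ltr01.
rewrite /Rintegral => ->.
- by rewrite !F0 ?ltxx ?andbF// !mul0r subr0 sub0r.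
- exact: continuous_subspaceT.
- exact: LR dF.
- by move=> x _; rewrite derive1E; have [_ ->] := dF x.
- exact: continuous_subspaceT.
- exact: LR dG.
- by move=> x _; rewrite derive1E; have [_ ->] := dG x.
Qed.

Lemma smooth_derive1 (R : realType) (phi : R -> R) :
  smooth phi -> smooth (derive1 phi).
Proof. by move=> sphi n x; have := sphi n.+1 x; rewrite /derive1n iterSr. Qed.

Lemma smooth_continuous (R : realType) (phi : R -> R) :
  smooth phi -> continuous phi.
Proof.
move=> sphi x; apply: differentiable_continuous; apply/derivable1_diffP.
exact: (sphi 0%N).
Qed.

(** Induction on [k] for all [phi] at once: the inductive hypothesis is applied
    to [phi'], and one more integration by parts moves the last derivative. *)
Lemma repeated_integration_by_parts (R : realType) (d : nat -> R -> R) (k : nat)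
    (phi : R -> R) :
  (forall j (x : R), (j < k)%N -> is_derive x 1 (d j) (d j.+1 x)) ->
  (forall j, (j <= k)%N -> continuous (d j)) ->
  (forall j x, (j <= k)%N -> ~~ (0 < x < 1) -> d j x = 0) ->
  smooth phi ->
  Rintegral lebesgue_measure setT (fun x => d 0%N x * derive1n k phi x) =
  (-1) ^+ k * Rintegral lebesgue_measure setT (fun x => d k x * phi x).
Proof.
elim: k phi => [|k IH] phi dd cd d0 sphi; first by rewrite expr0 mul1r.
have -> : derive1n k.+1 phi = derive1n k (derive1 phi) by rewrite /derive1n iterSr.
have dd' j (x : R) : (j < k)%N -> is_derive x 1 (d j) (d j.+1 x).
  by move=> jk; apply: dd; rewrite ltnS ltnW.
rewrite (IH _ dd') => [|j jk|j x jk|]; last exact: smooth_derive1.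
- have dk (x : R) : is_derive x 1 (d k) (d k.+1 x) by exact: dd.
  have dphi (x : R) : is_derive x 1 phi (derive1 phi x).
    by rewrite derive1E; apply: DeriveDef => //; exact: (sphi 0%N).
  rewrite (integration_by_parts_supp01 dk dphi).
  + by rewrite exprSr mulrN mulrN1 mulNr.
  + exact: cd.
  + exact/smooth_continuous/smooth_derive1.
  + by move=> x; apply: d0.
  + by move=> x; apply: d0.
- by apply: cd; rewrite leqW.
- by apply: d0; rewrite leqW.
Qed.

Lemma integral_ge_segment (R : realType) (g : R -> R) (a b c : R) :
  a <= b -> 0 <= c -> measurable_fun setT g -> (forall x, 0 <= g x) ->
  (forall x, a <= x <= b -> c <= g x) ->
  ((c * (b - a))%:E <= \int[lebesgue_measure]_x (g x)%:E)%E.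
Proof.
move=> ab c0 mg g0 gc.
have mg' : measurable_fun [set: R] (fun x => (g x)%:E) by exact/measurable_EFinP.
have -> : ((c * (b - a))%:E = \int[lebesgue_measure]_(x in `[a, b]) (cst c%:E) x)%E.
  rewrite integral_cst//= lebesgue_measure_itv/= lte_fin.
  move: ab; rewrite le_eqVlt => /orP[/eqP->|->]; last by rewrite -EFinB EFinM.
  by rewrite ltxx subrr mulr0 mule0.
apply: (@le_trans _ _ (\int[lebesgue_measure]_(x in `[a, b]) (g x)%:E)%E).
  by apply: ge0_le_integral => //; apply: measurable_funTS.
by apply: ge0_subset_integral => // x _; rewrite lee_fin.
Qed.

Lemma integral_supp01_le (R : realType) (g : R -> R) (c : R) :
  0 <= c -> measurable_fun setT g -> (forall x, 0 <= g x) ->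
  (forall x, ~~ (0 < x < 1) -> g x = 0) ->
  (forall x, 0 <= x <= 1 -> g x <= c) ->
  (\int[lebesgue_measure]_x (g x)%:E <= c%:E)%E.
Proof.
move=> c0 mg g0 gs gc.
have mg' : measurable_fun [set: R] (fun x => (g x)%:E) by exact/measurable_EFinP.
rewrite integral_supp01//.
have -> : (c%:E = \int[lebesgue_measure]_(x in `[0%R, 1%R]) (cst c%:E) x :> \bar R)%E.
  by rewrite integral_cst//= lebesgue_measure_itv/= lte_fin ltr01 oppr0 adde0 mule1.
apply: ge0_le_integral => //; last exact: measurable_funTS.
by move=> x _; rewrite lee_fin.
Qed.

Lemma normc_real (R : realType) (a : R) :
  ComplexField.Normc.normc (a%:C)%C = `|a|.
Proof. by rewrite /ComplexField.Normc.normc/= expr0n/= addr0 sqrtr_sqr. Qed.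

Lemma cintegral_real (R : realType) (h : R -> R) :
  cintegral (fun x => (h x)%:C%C) = (Rintegral lebesgue_measure setT h)%:C%C.
Proof.
rewrite /cintegral/=; congr Complex.
by rewrite /Rintegral integral0.
Qed.

Lemma cintegral_realM (R : realType) (f g : R -> R) :
  cintegral (fun x => (f x)%:C%C * (g x)%:C%C) =
  (Rintegral lebesgue_measure setT (fun x => f x * g x))%:C%C.
Proof. by rewrite -cintegral_real; congr cintegral; apply/funext => x; rewrite rmorphM. Qed.

Lemma continuous_locally_integrable (R : realType) (f : R -> R) :
  continuous f -> locally_integrable setT f.
Proof.
move=> cf; split; [exact: continuous_measurable_fun|exact: openT|].
move=> K _ cK.
have /integrableP[_] : lebesgue_measure.-integrable K (EFin \o f).
  by apply: continuous_compact_integrable => //; exact: continuous_subspaceT.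
exact.
Qed.

Lemma weak_derivative_supp01 (R : realType) (d : nat -> R -> R) (k : nat) :
  (forall j (x : R), (j < k)%N -> is_derive x 1 (d j) (d j.+1 x)) ->
  (forall j, (j <= k)%N -> continuous (d j)) ->
  (forall j x, (j <= k)%N -> ~~ (0 < x < 1) -> d j x = 0) ->
  weak_derivative k (fun x => (d 0%N x)%:C%C) (fun x => (d k x)%:C%C).
Proof.
move=> dd cd d0.
have li j : (j <= k)%N -> clocally_integrable (fun x => (d j x)%:C%C).
  move=> jk; split; apply: continuous_locally_integrable; first exact: cd.
  by move=> x; apply: cvg_cst.
split; [exact: li|exact: li|move=> phi [sphi _]].
rewrite !cintegral_realM repeated_integration_by_parts//.
by rewrite rmorphM rmorphXn rmorphN rmorph1.
Qed.

(** * Sobolev norm and integral of a train of bumps *)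

Lemma continuous_real_complex (R : realType) (f : R -> R) :
  continuous f -> continuous ((fun x => (f x)%:C%C) : R -> R[i]^o).
Proof.
move=> cf x; apply/cvgrPdist_lt => e e0.
have : 0 < complex.Re e by move: e0; rewrite ltcE => /andP[].
have eE : e = (complex.Re e)%:C%C.
  by case: e e0 => a b; rewrite ltcE /= => /andP[/eqP -> _].
move=> r0; rewrite eE.
have := cf x; move/cvgrPdist_lt => /(_ _ r0); apply: filterS => y.
by rewrite -rmorphB normc_def /= expr0n /= addr0 sqrtr_sqr ltcR.
Qed.

Lemma measurable_weighted_power (R : realType) (d rho : R -> R) (q : R) :
  continuous d -> continuous rho ->
  measurable_fun [set: R] (fun x => `|d x| `^ q * rho x).
Proof.
move=> cd crho; apply: measurable_funM; last exact: continuous_measurable_fun.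
apply: (measurableT_comp (measurable_powR _)).
by apply: measurableT_comp => //; exact: continuous_measurable_fun.
Qed.

Lemma weighted_sobolev_norm_real (R : realType) A (q : R) (rho : R -> R)
    (d : nat -> R -> R) :
  weighted_sobolev_norm A q rho (fun k x => (d k x)%:C%C) =
  ((\sum_(0 <= k < A.+1) \int[lebesgue_measure]_x (`|d k x| `^ q * rho x)%R%:E)
     `^ q^-1)%E.
Proof.
rewrite /weighted_sobolev_norm; congr (_ `^ _)%E; apply: eq_bigr => k _.
by apply: eq_integral => x _; rewrite normc_real.
Qed.

(** On functions supported in [0, 1], an interval of length 1, each of the
    [A+1] integrals in the norm is at most the pointwise bound [K^q M] of its
    integrand. *)
Lemma weighted_sobolev_norm_le (R : realType) A (q K M : R) (rho : R -> R)
    (d : nat -> R -> R) :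
  0 < q -> 0 <= K -> 0 <= M -> continuous rho -> (forall x, 0 < rho x) ->
  (forall x, 0 <= x <= 1 -> rho x <= M) ->
  (forall k, (k <= A)%N -> continuous (d k)) ->
  (forall k x, (k <= A)%N -> ~~ (0 < x < 1) -> d k x = 0) ->
  (forall k x, (k <= A)%N -> `|d k x| <= K) ->
  (weighted_sobolev_norm A q rho (fun k x => (d k x)%:C%C) <=
    (K * (A.+1%:R * M) `^ q^-1)%:E)%E.
Proof.
move=> q0 K0 M0 crho rho0 rhoM cd d0 dK; rewrite weighted_sobolev_norm_real.
have -> : K * (A.+1%:R * M) `^ q^-1 = (A.+1%:R * (K `^ q * M)) `^ q^-1.
  rewrite mulrCA [in RHS]powRM ?powR_ge0 ?mulr_ge0//.
  by rewrite -powRrM divff ?gt_eqF// powRr1.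
rewrite -poweR_EFin; apply: gt0_ler_poweR.
- by rewrite invr_ge0 ltW.
- rewrite in_itv/= leey andbT; apply: sume_ge0 => k _; apply: integral_ge0 => x _.
  by rewrite lee_fin mulr_ge0 ?powR_ge0// ltW.
- by rewrite in_itv/= leey andbT lee_fin mulr_ge0// mulr_ge0// powR_ge0.
have -> : (A.+1%:R * (K `^ q * M))%:E = (\sum_(0 <= k < A.+1) (K `^ q * M)%:E)%E.
  by rewrite sumEFin big_const_nat subn0 iter_addr_0 mulr_natl.
rewrite big_nat [leRHS]big_nat; apply: lee_sum => k /andP[_]; rewrite ltnS => kA.
apply: integral_supp01_le.
- by rewrite mulr_ge0// powR_ge0.
- exact: measurable_weighted_power (cd _ kA) crho.
- by move=> x; rewrite mulr_ge0 ?powR_ge0// ltW.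
- by move=> x /(d0 _ _ kA) ->; rewrite normr0 powR0 ?mul0r// gt_eqF.
- move=> x x01; apply: ler_pM; rewrite ?powR_ge0 ?(ltW (rho0 _)) ?rhoM//.
  by apply: ge0_ler_powR; rewrite ?nnegrE ?dK // ltW.
Qed.

(** Division by the norm is only meaningful when the norm is nonzero, for which
    a lower bound for [d 0] on a single interval suffices. *)
Lemma weighted_sobolev_norm_gt0 (R : realType) A (q a b c r : R) (rho : R -> R)
    (d : nat -> R -> R) :
  0 < q -> a < b -> 0 < c -> 0 < r -> continuous rho -> (forall x, 0 < rho x) ->
  continuous (d 0%N) ->
  (forall x, a <= x <= b -> r <= rho x) ->
  (forall x, a <= x <= b -> c <= d 0%N x) ->
  (0 < weighted_sobolev_norm A q rho (fun k x => (d k x)%:C%C))%E.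
Proof.
move=> q0 ab c0 r0 crho rho0 cd rrho cd0; rewrite weighted_sobolev_norm_real.
have g0 k x : 0 <= `|d k x| `^ q * rho x by rewrite mulr_ge0 ?powR_ge0// ltW.
apply: poweR_gt0; rewrite big_nat_recl//.
apply: (@lt_le_trans _ _ (\int[lebesgue_measure]_x (`|d 0%N x| `^ q * rho x)%R%:E)%E).
  apply: (@lt_le_trans _ _ (c `^ q * r * (b - a))%:E).
    by rewrite lte_fin mulr_gt0 ?subr_gt0// mulr_gt0// powR_gt0.
  apply: integral_ge_segment => //; first exact: ltW.
  - by rewrite mulr_ge0 ?powR_ge0// ltW.
  - exact: measurable_weighted_power.
  - move=> x xab; apply: ler_pM; rewrite ?powR_ge0 ?(ltW r0) ?rrho//.
    apply: ge0_ler_powR; rewrite ?nnegrE ?(ltW q0) ?(ltW c0)//.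
    by apply: (le_trans (cd0 _ xab)); exact: ler_norm.
rewrite leeDl//; apply: sume_ge0 => k _; apply: integral_ge0 => x _.
by rewrite lee_fin.
Qed.

(** The bump is at least [16^-(A+2)] on the middle half of its cell, and the
    other terms of the train are nonnegative. *)
Lemma bump_train_middle (R : realType) A m s i (x : R) : (0 < m)%N ->
  i \in s -> (i%:R + 4^-1) / m%:R <= x <= (i%:R + 3 / 4) / m%:R ->
  16^-1 ^+ A.+2 <= bump_train A m s 0 x.
Proof.
move=> m0 si; rewrite ler_pdivrMr ?ltr0n// ler_pdivlMr ?ltr0n// => /andP[h1 h2].
rewrite /bump_train expr0 mul1r (bigID (pred1 i))/=.
rewrite -[leLHS]addr0; apply: lerD; last by apply: sumr_ge0 => j _; exact: polybump_ge0.
have hi : 16^-1 ^+ A.+2 <= polybump A 0 (m%:R * x - i%:R).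
  by apply: polybump_middle; apply/andP; split; lra.
elim: s si => // a s IH; rewrite inE big_cons => /orP[/eqP <-|/IH {}IH].
  rewrite eqxx; apply: (le_trans hi); rewrite lerDl.
  by apply: sumr_ge0 => j _; exact: polybump_ge0.
case: ifP => // _; apply: (le_trans IH); rewrite lerDr; exact: polybump_ge0.
Qed.

(** Each of the [size s] copies is at least [16^-(A+2)] on the middle half of its
    cell, an interval of length [1/(2m)]. *)
Lemma integral_bump_train_ge (R : realType) A m s (r : R) (rho : R -> R) :
  (0 < m)%N -> (forall i, i \in s -> (i < m)%N) -> 0 <= r ->
  continuous rho -> (forall x, 0 < rho x) ->
  (forall x, 0 <= x <= 1 -> r <= rho x) ->
  (((size s)%:R * (16^-1 ^+ A.+2 * r / (2 * m%:R)))%:E <=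
   \int[lebesgue_measure]_x (bump_train A m s 0 x * rho x)%:E)%E.
Proof.
move=> m0 sm r0 crho rho0 rrho.
have m0' : 0 < m%:R :> R by rewrite ltr0n.
pose g i x := polybump A 0 (m%:R * x - i%:R) * rho x.
have g0 i x : 0 <= g i x by rewrite mulr_ge0 ?polybump_ge0// ltW.
have cg i : continuous (g i).
  move=> x; apply: cvgM; last exact: crho.
  apply: (@continuous_comp _ _ _ (fun t : R => m%:R * t - i%:R) (polybump A 0)).
    by apply: cvgB; [apply: cvgM; [exact: cvg_cst|exact: cvg_id]|exact: cvg_cst].
  exact: polybump_continuous.
have mg i : measurable_fun [set: R] (g i) by exact: continuous_measurable_fun.
have -> : (\int[lebesgue_measure]_x (bump_train A m s 0 x * rho x)%:E =
    \sum_(i <- s) \int[lebesgue_measure]_x (g i x)%:E)%E.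
  rewrite -ge0_integral_sum//.
  - apply: eq_integral => x _; rewrite sumEFin; congr EFin.
    by rewrite /bump_train expr0 mul1r mulr_suml.
  - by move=> i; apply/measurable_EFinP; exact: mg.
  - by move=> i x _; rewrite lee_fin.
have -> : (((size s)%:R * (16^-1 ^+ A.+2 * r / (2 * m%:R)))%:E =
    \sum_(i <- s) (16^-1 ^+ A.+2 * r / (2 * m%:R))%:E)%E.
  by rewrite sumEFin big_const_seq count_predT iter_addr_0 mulr_natl.
rewrite big_seq [leRHS]big_seq; apply: lee_sum => i si.
have e : 16^-1 ^+ A.+2 * r / (2 * m%:R) = 16^-1 ^+ A.+2 * r *
    ((i%:R + 3 / 4) / m%:R - (i%:R + 4^-1) / m%:R) :> R.
  by field; rewrite gt_eqF.
rewrite e; apply: integral_ge_segment => //.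
- by rewrite ler_pM2r ?invr_gt0// lerD2l; lra.
- by rewrite mulr_ge0// exprn_ge0.
- move=> x hx; move: (hx).
  rewrite ler_pdivrMr// ler_pdivlMr// => /andP[h1 h2].
  have i0 : 0 <= i%:R :> R by [].
  have im : i%:R + 1 <= m%:R :> R by rewrite natr1 ler_nat sm.
  apply: ler_pM => //.
    by apply: polybump_middle; apply/andP; split; lra.
  by apply: rrho; apply/andP; split; nra.
Qed.

(** * The lower bound *)

Theorem proposition3p4 (R : realType) (rho : R -> R) (q : R) (alpha : nat)
    (hrho : schwartz_mon_pos rho) (hq : 1 < q) (halpha : (1 <= alpha)%N) :
  exists2 C : R, 0 < C &
    forall n : nat, (1 <= n)%N -> forall w x : 'I_n -> R,
      ((C * (1 / n%:R ^+ alpha))%:E <=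
        operator_norm alpha q rho
          (fun f => (weighted_integral rho f - quadrature w x f)%R))%E.
Proof.
case: hrho => -[/smooth_continuous crho _] rho0 _.
have q0 : 0 < q by exact: lt_trans hq.
have crho01 : {within `[0, 1], continuous rho} by exact: continuous_subspaceT.
have [xr _ rmin] := EVT_min ler01 crho01.
have [xM _ Mmax] := EVT_max ler01 crho01.
set r := rho xr in rmin; set M := rho xM in Mmax.
have r0 : 0 < r by exact: rho0.
have M0 : 0 < M by exact: rho0.
have rrho x : 0 <= x <= 1 -> r <= rho x by move=> h; apply: rmin; rewrite in_itv.
have rhoM x : 0 <= x <= 1 -> rho x <= M by move=> h; apply: Mmax; rewrite in_itv.
have [B B0 HB] := polybump_bounded R alpha.
pose beta : R := 16^-1 ^+ alpha.+2.
have beta0 : 0 < beta by rewrite exprn_gt0.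
pose c := (alpha.+1%:R * M) `^ q^-1.
have c0 : 0 < c by rewrite powR_gt0// mulr_gt0.
(* The error of the train of bumps is at least [beta * r / 4], and its norm at
   most [(2n)^alpha * B * c]. *)
exists (beta * r / 4 / (2 ^+ alpha * B * c)).
  have p0 : 0 < 2 ^+ alpha :> R by rewrite exprn_gt0.
  by apply: divr_gt0; [apply: divr_gt0 => //; apply: mulr_gt0|do 2! apply: mulr_gt0 => //].
move=> n n0 w x.
have n0' : 0 < n%:R :> R by rewrite ltr0n.
have [s [us ss sm sx]] := free_cells x.
set m := (2 * n)%N in sm sx.
have m0 : (0 < m)%N by rewrite muln_gt0.
have m0' : 0 < m%:R :> R by rewrite ltr0n.
pose d := @bump_train R alpha m s.
have dd k (y : R) : (k <= alpha)%N -> is_derive y 1 (d k) (d k.+1 y).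
  exact: is_derive_bump_train.
have cd k : (k <= alpha)%N -> continuous (d k) by exact: bump_train_continuous.
have d0 k y : (k <= alpha)%N -> ~~ (0 < y < 1) -> d k y = 0.
  by move=> ka; exact: bump_train_out.
have dK k y : (k <= alpha)%N -> `|d k y| <= m%:R ^+ alpha * B.
  move=> ka; apply: le_trans (bump_train_bounded m y ka us _) _ => [z|].
    exact: HB ka.
  by rewrite ler_pM2r// ler_weXn2l// ler1n.
have d_ge0 y : 0 <= d 0%N y.
  by rewrite mulr_ge0 ?exprn_ge0//; apply: sumr_ge0 => i _; exact: polybump_ge0.
have [i si] : exists i, i \in s.
  by case: s ss {us sm sx d dd cd d0 dK d_ge0} => [n00|i s _];
    [move: n0; rewrite -n00|exists i; rewrite mem_head].
have im : i%:R + 1 <= m%:R :> R by rewrite natr1 ler_nat sm.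
pose W := weighted_sobolev_norm alpha q rho (fun k y => (d k y)%:C%C).
have W_le : (W <= (m%:R ^+ alpha * B * c)%:E)%E.
  apply: weighted_sobolev_norm_le => //; last exact: ltW.
  by rewrite mulr_ge0 ?exprn_ge0// ltW.
(* Any one of the occupied cells witnesses that the train is nonzero. *)
have W_gt0 : (0 < W)%E.
  apply: (@weighted_sobolev_norm_gt0 _ _ _ ((i%:R + 4^-1) / m%:R)
    ((i%:R + 3 / 4) / m%:R) beta r) => //.
  - by rewrite ltr_pM2r ?invr_gt0// ltrD2l; lra.
  - exact: cd.
  - move=> y; rewrite ler_pdivrMr// ler_pdivlMr// => /andP[h1 h2].
    have i0 : 0 <= i%:R :> R by [].
    by apply: rrho; apply/andP; split; nra.
  - by move=> y; exact: bump_train_middle.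
have Wfin : W \is a fin_num.
  by rewrite ge0_fin_numE ?(ltW W_gt0)//; apply: le_lt_trans W_le (ltry _).
have W0 : 0 < fine W by rewrite -lte_fin fineK.
pose I := (\int[lebesgue_measure]_y (d 0%N y * rho y)%:E)%E.
have br0 : 0 < beta * r / 4 by apply: divr_gt0 => //; apply: mulr_gt0.
have I_ge : ((beta * r / 4)%:E <= I)%E.
  have := @integral_bump_train_ge R alpha m s r rho m0 sm (ltW r0) crho rho0 rrho.
  rewrite ss; apply: le_trans; rewrite lee_fin le_eqVlt; apply/orP; left.
  by apply/eqP; rewrite /m natrM /beta; field; rewrite gt_eqF.
have I_le : (I <= (m%:R ^+ alpha * B * M)%:E)%E.
  apply: integral_supp01_le.
  - by rewrite !mulr_ge0 ?exprn_ge0// ltW.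
  - apply: continuous_measurable_fun => y; apply: cvgM; last exact: crho.
    exact: cd.
  - by move=> y; rewrite mulr_ge0// ltW.
  - by move=> y y01; rewrite d0// mul0r.
  - move=> y y01; apply: ler_pM; rewrite ?(ltW (rho0 _)) ?rhoM//.
    by apply: le_trans (ler_norm _) _; exact: dK.
have I_real : beta * r / 4 <= fine I.
  rewrite -lee_fin fineK// fin_real//.
  by rewrite (lt_le_trans _ I_ge) ?ltNyr// (le_lt_trans I_le) ?ltry.
pose f y := (d 0%N y)%:C%C.
have f_node j : f (x j) = 0.
  by rewrite /f /d bump_train_eq0// => k ks; exact: sx.
have Tf : weighted_integral rho f - quadrature w x f = (fine I)%:C%C.
  rewrite /quadrature big1 ?subr0 => [|j _]; last by rewrite f_node mulr0.
  by rewrite /weighted_integral cintegral_realM.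
apply: (@le_trans _ _ (fine I / fine W)%:E); last first.
  apply: ereal_sup_ubound; exists f, (fun k y => (d k y)%:C%C); split.
  - split; last by rewrite -ge0_fin_numE// ltW.
      by apply: continuous_real_complex; exact: cd.
    move=> k ka; apply: weak_derivative_supp01.
    + by move=> j y jk; apply: dd; rewrite (leq_trans (ltnW jk)).
    + by move=> j jk; apply: cd; rewrite (leq_trans jk).
    + by move=> j y jk; apply: d0; rewrite (leq_trans jk).
  - move=> f0; move: I_real; apply/negP; rewrite -ltNge.
    have -> : fine I = 0.
      rewrite /I integral0_eq// => y _; congr EFin.
      by have /(congr1 (@complex.Re R)) /= -> := congr1 (@^~ y) f0; rewrite mul0r.
    exact: br0.
  - by rewrite Tf normc_real ger0_norm// ltW// (lt_le_trans br0).
rewrite lee_fin ler_pdivlMr//; apply: le_trans I_real.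
apply: (@le_trans _ _ (beta * r / 4 / (2 ^+ alpha * B * c) * (1 / n%:R ^+ alpha) *
    (m%:R ^+ alpha * B * c))).
  apply: ler_wpM2l; last by rewrite -lee_fin fineK.
  apply: mulr_ge0; last by rewrite div1r invr_ge0 exprn_ge0.
  by apply: divr_ge0; [exact: ltW|rewrite !mulr_ge0 ?exprn_ge0 ?ltW].
rewrite le_eqVlt; apply/orP; left; apply/eqP.
rewrite /m natrM exprMn; field.
by rewrite !expf_neq0 ?gt_eqF.
Qed.
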